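(* There exists a universal constant $C_3 > 0$ such that the following holds. For every integer $n \ge 1$ and all real numbers $a_1 \ge \ldots \ge a_n \ge 0$ with $\sum_{i=1}^n a_i^2 = 1$, if $\varepsilon_1, \ldots, \varepsilon_n$ are i.i.d. Rademacher random variables, $S = \sum_{i=1}^n a_i \varepsilon_i$ and $S_n = \frac{1}{\sqrt n} \sum_{i=1}^n \varepsilon_i$, then $$\mathbb{E}|S|^3 \le \mathbb{E}|S_n|^3 - \frac{C_3}{a_1^2 + \frac1n} \sum_{i=1}^n \sqrt{\frac1n\left(a_i^2 + a_n^2 - \frac1n\right)}\left(a_i^2 - \frac1n\right)_+\left(\frac1n - a_{n+1-i}^2\right)_+ .$$
   Context: A Rademacher random variable $\varepsilon$ satisfies $\mathbb{P}(\varepsilon = 1) = \mathbb{P}(\varepsilon = -1) = \frac12$. For $x \in \mathbb{R}$, $x_+ = \max\{x, 0\}$. Any summand with $a_i^2 \le \frac1n$ (so that the factor $(a_i^2 - \frac1n)_+$ vanishes) is understood to be $0$, even if the expression under the square root is negative; if $a_i^2 > \frac1n$ the expression under the square root is positive. *)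

(* Defs.v *)
From HB Require Import structures.
From mathcomp Require Import all_boot all_order all_algebra.
From mathcomp Require Import all_classical all_reals all_analysis.

Set Implicit Arguments.
Unset Strict Implicit.
Unset Printing Implicit Defensive.

Import Order.TTheory GRing.Theory Num.Theory.

Local Open Scope classical_set_scope.
Local Open Scope ring_scope.

Definition rademacher d (T : measurableType d) (R : realType)
    (P : probability T R) (X : {RV P >-> R}) : Prop :=
  P (X @^-1` [set 1]) = (2^-1)%:E /\ P (X @^-1` [set -1]) = (2^-1)%:E.

(* Mutual (not merely pairwise) independence: the product rule over every
   subfamily J and all Borel sets A i. *)
Definition mutually_independent d (T : measurableType d) (R : realType)
    (P : probability T R) (I : finType) (X : I -> {RV P >-> R}) : Prop :=
  forall (J : {set I}) (A : I -> set R), (forall i, measurable (A i)) ->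
    P (\bigcap_(i in [set i | i \in J]) (X i @^-1` A i)) =
    (\prod_(i in J) P (X i @^-1` A i))%E.

(* Main.v *)
Require Import Defs.
From HB Require Import structures.
From mathcomp Require Import all_boot all_order all_algebra.
From mathcomp Require Import all_classical all_reals all_analysis.
From mathcomp Require Import measurable_realfun ring lra.

Set Implicit Arguments.
Unset Strict Implicit.
Unset Printing Implicit Defensive.

Import Order.TTheory GRing.Theory Num.Theory.

Local Open Scope ring_scope.

(* Write x_i = a_i^2. As long as x is not constant, replace its largest entry x_p
   and its smallest entry x_q by 1/n and x_p + x_q - 1/n; after finitely many
   steps x is constant, and the k-th step acts on a maximum at least as large as
   the k-th largest entry of the original x, and on a minimum at most as large as
   the k-th smallest. Hence it is enough that one step gains
     C sqrt(1/n (x_p + x_q - 1/n)) (x_p - 1/n) (1/n - x_q) / (x_p + x_q).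
   Conditionally on the sum W of the other terms, E|S|^3 is an average of the
   values at s + u and s - u of a convex function of v = r^2, where s = x_p + x_q
   and u = 2 a_p a_q. It is strictly convex on v > W^2, so on the event W^2 <= s
   the gain is of order (u_new^3 - u_old^3) / s^(3/2), and
   u_new^2 - u_old^2 = 4 (x_p - 1/n) (1/n - x_q). As all coefficients of W are at
   most sqrt s, that event has probability at least of order sqrt s. *)

(* The expectation of f (sum_i s_i eps_i) for independent Rademacher eps_i. *)
Fixpoint rad (R : realType) (s : seq R) (f : R -> R) : R :=
  if s is a :: s' then
    (rad s' (fun x => f (a + x)) + rad s' (fun x => f (- a + x))) / 2
  else f 0.

(** * Rademacher averages by recursion on the coefficients *)

Section RadTheory.
Variable R : realType.
Implicit Types (s X Y : seq R) (f g : R -> R).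

Lemma eq_rad s f g : f =1 g -> rad s f = rad s g.
Proof.
elim: s f g => [|a s IH] f g fg //=.
by congr ((_ + _) / _); apply: IH => x; apply: fg.
Qed.

Lemma rad_le s f g : (forall x, f x <= g x) -> rad s f <= rad s g.
Proof.
elim: s f g => [|a s IH] f g fg //=.
by rewrite ler_pM2r ?invr_gt0// lerD// IH.
Qed.

Lemma radD s f g : rad s (fun x => f x + g x) = rad s f + rad s g.
Proof. by elim: s f g => [|a s IH] f g //=; rewrite !IH; field. Qed.

Lemma radZ s c f : rad s (fun x => c * f x) = c * rad s f.
Proof. by elim: s f => [|a s IH] f //=; rewrite !IH; field. Qed.

Lemma rad_cst s c : rad s (fun=> c) = c.
Proof. by elim: s => [|a s IH] //=; rewrite !IH; field. Qed.

Lemma rad_sum s N (F : nat -> R -> R) :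
  rad s (fun x => \sum_(j < N) F j x) = \sum_(j < N) rad s (F j).
Proof.
elim: N => [|N IH].
  by rewrite big_ord0 -[RHS](rad_cst s); apply: eq_rad => x; rewrite big_ord0.
rewrite big_ord_recr /= -IH -radD; apply: eq_rad => x.
by rewrite big_ord_recr.
Qed.

Lemma rad_cat X Y f :
  rad (X ++ Y) f = rad X (fun x => rad Y (fun y => f (x + y))).
Proof.
elim: X f => [|a X IH] f /=; first by apply: eq_rad => x; rewrite add0r.
by rewrite !IH; congr (_ / _); congr (_ + _); apply: eq_rad => x;
  apply: eq_rad => y; rewrite addrA.
Qed.

Lemma rad_exchange X Y (F : R -> R -> R) :
  rad X (fun x => rad Y (F x)) = rad Y (fun y => rad X (F^~ y)).
Proof.
elim: X F => [|a X IH] F //=.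
by rewrite (IH (fun x => F (a + x))) (IH (fun x => F (- a + x))) -radD
  mulrC -radZ; apply: eq_rad => y; rewrite mulrC.
Qed.

Lemma perm_rad X Y f : perm_eq X Y -> rad X f = rad Y f.
Proof.
move=> XY; apply/eqP; rewrite perm_sym in XY.
refine (@catCA_perm_ind _ (fun s => rad s f == rad Y f) _ _ _ XY _) => //.
move=> s1 s2 s3 /eqP <-; apply/eqP.
rewrite !rad_cat.
under eq_rad do rewrite rad_cat.
under [RHS]eq_rad do rewrite rad_cat.
rewrite rad_exchange; apply: eq_rad => y; apply: eq_rad => x.
by apply: eq_rad => z; rewrite addrCA.
Qed.

Lemma rad_sqr s : rad s (fun x => x ^+ 2) = \sum_(a <- s) a ^+ 2.
Proof.
suff sq c : rad s (fun x => (c + x) ^+ 2) = c ^+ 2 + \sum_(a <- s) a ^+ 2.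
  by rewrite -[RHS]add0r -[X in X + _](expr0n R 2) -sq; apply: eq_rad => x;
    rewrite add0r.
elim: s c => [|a s IH] c /=; first by rewrite big_nil !addr0.
rewrite big_cons.
under eq_rad do rewrite addrA.
under [X in _ + X]eq_rad do rewrite addrA.
by rewrite !IH; field.
Qed.

(** Giving both sums the same signs keeps them within distance [D] of each other. *)
Lemma rad_coupling X Y f g (D : R) : size X = size Y ->
    \sum_(z <- zip X Y) `|z.1 - z.2| <= D ->
    (forall x y, `|x - y| <= D -> f x <= g y) ->
  rad X f <= rad Y g.
Proof.
elim: X Y f g D => [|a X IH] [|b Y] f g D //= => [_|[szXY]].
  by rewrite big_nil => D0; apply; rewrite subr0 normr0.
rewrite big_cons /= => dXY fg.
rewrite ler_pM2r ?invr_gt0//; apply: lerD;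
  apply: (IH _ _ _ (D - `|a - b|)) => //; rewrite ?lerBrDl// => x y xy;
  apply: fg.
  have -> : a + x - (b + y) = (a - b) + (x - y) by ring.
  have := ler_normD (a - b) (x - y); lra.
have -> : - a + x - (- b + y) = - (a - b) + (x - y) by ring.
have := ler_normD (- (a - b)) (x - y); rewrite normrN; lra.
Qed.

(* X and Y collect the terms of z of even and odd index, so that the distance
   between them telescopes. *)
Lemma sorted_split (z : seq R) (h : R) :
    path (fun u v => v <= u) h z -> all (fun u => 0 <= u) (h :: z) ->
  exists X Y, [/\ size X = size Y, \sum_(t <- zip X Y) `|t.1 - t.2| <= h,
    \sum_(u <- X) u ^+ 2 <= \sum_(u <- z) u ^+ 2 &
    forall f, rad z f = rad X (fun x => rad Y (fun y => f (x - y)))].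
Proof.
have [k] := ubnP (size z); elim: k z h => // k IH [|u [|v z]] h.
- move=> _ _ /= /andP[h0 _]; exists [::], [::].
  by rewrite !big_nil; split => // f; rewrite /= subr0.
- move=> _ /= /andP[uh _] /and3P[h0 u0 _]; exists [:: u], [:: 0].
  rewrite /= !big_cons !big_nil !addr0 subr0 ger0_norm//; split => // f /=.
  by rewrite !(addr0, subr0, oppr0); field.
- rewrite /= ltnS => szz /and3P[uh vu vz] /and4P[h0 u0 v0 z0].
  have [||X [Y [szXY dXY sqX radz]]] := IH z v _ vz; first exact: ltnW.
    by rewrite /= v0.
  exists (u :: X), (v :: Y); rewrite /= szXY !big_cons /=; split => //.
  + rewrite ger0_norm ?subr_ge0//; lra.
  + by rewrite lerD2l (le_trans sqX)// lerDr sqr_ge0.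
  + move=> f; rewrite !radz.
    (* The halves come out swapped because [v] enters [x - y] with the opposite sign. *)
    have radH g1 g2 : rad X (fun x => (g1 x + g2 x) / 2) =
        (rad X g2 + rad X g1) / 2.
      by rewrite mulrC -radD -radZ; apply: eq_rad => x; rewrite mulrC addrC.
    rewrite !radH; congr ((_ + _) / _); congr ((_ + _) / _);
      by apply: eq_rad => x; apply: eq_rad => y; congr f; ring.
Qed.
End RadTheory.

(** * Small-ball estimate for Rademacher sums *)

Section SmallBall.
Variable R : realType.
Implicit Types (s X Y : seq R).

(** The indicator is at least 1 - x^2/4, and the variance is at most 1. *)
Lemma rad_chebyshev X : \sum_(u <- X) u ^+ 2 <= 1 ->
  3 / 4 <= rad X (fun x => (`|x| <= 2)%R%:R).
Proof.
move=> X1; apply: (@le_trans _ _ (rad X (fun x => 1 + (- 4^-1) * x ^+ 2))).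
  by rewrite radD radZ rad_cst rad_sqr; lra.
apply: rad_le => x; have [|] := leP `|x| 2 => x2 /=.
  have := sqr_ge0 x; lra.
have : 2 ^+ 2 < `|x| ^+ 2 by rewrite ltr_pXn2r ?nnegrE.
rewrite real_normK ?num_real//; lra.
Qed.

(** Pigeonhole: [-2, 2] is covered by at most 5/sigma bins of length sigma, which carry mass at
    least 3/4. Two independent copies in one bin are sigma-close, so the sum of the squared bin
    probabilities is a lower bound. *)
Lemma rad_collision X (sigma : R) : 0 < sigma -> sigma <= 1 ->
    \sum_(u <- X) u ^+ 2 <= 1 ->
  7 / 64 * sigma <=
    rad X (fun x => rad X (fun y => (`|x - y| <= sigma)%R%:R)).
Proof.
move=> s0 s1 X1.
pose bin (x : R) := Num.truncn ((x + 2) / sigma).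
pose N := (Num.truncn (4 / sigma)).+1.
pose u j x : R := ((`|x| <= 2)%R && (bin x == j))%:R.
have NE : N%:R * sigma <= 5.
  rewrite -ler_pdivlMr// /N -natr1.
  have : (Num.truncn (4 / sigma))%:R <= 4 / sigma.
    by rewrite truncn_le// divr_ge0// ltW.
  have : 1 <= 1 / sigma by rewrite ler_pdivlMr// mul1r.
  lra.
have binP x : `|x| <= 2 ->
    (bin x)%:R * sigma <= x + 2 < ((bin x)%:R + 1) * sigma.
  rewrite ler_norml => /andP[x2 _].
  rewrite -ler_pdivlMr// -ltr_pdivrMr// natr1; apply: truncn_itv.
  by rewrite divr_ge0// ?(ltW s0)//; lra.
have sum_u x : \sum_(j < N) u j x = (`|x| <= 2)%R%:R.
  rewrite /u; case: (boolP (`|x| <= 2)) => x2 /=; last by rewrite big1.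
  have binN : (bin x < N)%N.
    rewrite ltnS; apply: le_truncn; rewrite ler_pM2r ?invr_gt0//.
    by move: x2; rewrite ler_norml; lra.
  rewrite (bigD1 (Ordinal binN))//= eqxx big1 ?addr0// => i.
  by rewrite -val_eqE /= eq_sym => /negbTE ->.
have collide x y : \sum_(j < N) u j x * u j y <= (`|x - y| <= sigma)%R%:R.
  have [xy|] := boolP (`|x - y| <= sigma) => /=; last first.
    move=> xy; rewrite big1// => j _; rewrite /u -natrM mulnb.
    case: (boolP (_ && _)) => // /and3P[]/andP[x2 /eqP bx y2 /eqP bY].
    case/negP: xy; have := binP _ x2; have := binP _ y2; rewrite bx bY.
    rewrite ler_norml; lra.
  apply: (@le_trans _ _ (\sum_(j < N) u j x)).
    by apply: ler_sum => j _; rewrite ler_piMr// /u ?ler0n// lern1 leq_b1.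
  by rewrite sum_u lern1 leq_b1.
apply: (@le_trans _ _ (\sum_(j < N) rad X (u j) ^+ 2)).
  (* Each square is bounded below by its tangent at sigma/8; the sum is at least 3/16 sigma - 5/64
     sigma = 7/64 sigma. *)
  apply: (@le_trans _ _ (\sum_(j < N)
      (sigma / 4 * rad X (u j) - (sigma / 8) ^+ 2))).
    rewrite big_split /= -mulr_sumr sumr_const card_ord -mulr_natl -rad_sum.
    rewrite (eq_rad _ sum_u).
    have := rad_chebyshev X1; nra.
  apply: ler_sum => j _; have := sqr_ge0 (rad X (u j) - sigma / 8); nra.
rewrite (_ : \sum_(_ < _) _ = rad X (fun x => rad X
    (fun y => \sum_(j < N) u j x * u j y))).
  by apply: rad_le => x; apply: rad_le => y.
transitivity (rad X (fun x => \sum_(j < N) rad X (u j) * u j x)).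
  rewrite (rad_sum _ _ (fun j x => rad X (u j) * u j x)).
  by apply: eq_bigr => j _; rewrite radZ expr2.
apply: eq_rad => x; rewrite (rad_sum _ _ (fun j y => u j x * u j y)).
by apply: eq_bigr => j _; rewrite radZ mulrC.
Qed.

(* Without the largest coefficient a, the window may be enlarged to sigma + a.
   The remaining sum is X(e) - Y(e') with |X(e') - Y(e')| <= a for every choice of
   signs e', so it is enough that X(e) and X(e') fall at distance at most sigma,
   which a pigeonhole argument on windows of length sigma provides. *)
Lemma rad_small_ball s (sigma : R) : 0 < sigma -> sigma <= 1 ->
    (forall u, u \in s -> 0 <= u <= sigma) -> \sum_(u <- s) u ^+ 2 <= 1 ->
  7 / 128 * sigma <= rad s (fun x => (`|x| <= sigma)%R%:R).
Proof.
move=> s0 s1.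
have ge_trans : transitive (fun u v : R => v <= u).
  by move=> x y z yx xz; apply: le_trans xz yx.
have st : perm_eq (sort (fun u v : R => v <= u) s) s by rewrite perm_sort.
have sst : sorted (fun u v : R => v <= u) (sort (fun u v : R => v <= u) s).
  by apply: sort_sorted => u v; apply: le_total.
move=> bs; rewrite -(perm_big _ st) /= -(perm_rad _ st).
have {bs} : all (fun u => 0 <= u <= sigma) (sort (fun u v : R => v <= u) s).
  by apply/allP => u; rewrite (perm_mem st); apply: bs.
move: (sort _ s) sst => {st}s'.
case: s' => [_ _ _|a z az]; first by rewrite /= normr0 (ltW s0) mulr1n; lra.
move=> bz; rewrite big_cons => sq.
have /andP[a0 asig] : 0 <= a <= sigma by case/andP: bz.
have pos : all (fun u => 0 <= u) (a :: z).
  by apply: sub_all bz => u /andP[].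
have [X [Y [szXY dXY sqX radz]]] := sorted_split az pos.
have sqX1 : \sum_(u <- X) u ^+ 2 <= 1 by have := sqr_ge0 a; lra.
apply: (@le_trans _ _ (rad z (fun x => 2^-1 * (`|x| <= sigma + a)%R%:R))).
  rewrite radZ radz.
  rewrite (_ : 7 / 128 * _ = 2^-1 * (7 / 64 * sigma)); last by field.
  rewrite ler_pM2l ?invr_gt0//; apply: le_trans (rad_collision s0 s1 sqX1) _.
  apply: rad_le => x; apply: (rad_coupling szXY dXY) => y y' yy'.
  have [xy|//] := leP `|x - y| sigma.
  suff -> : `|x - y'| <= sigma + a by [].
  have -> : x - y' = (x - y) + (y - y') by ring.
  have := ler_normD (x - y) (y - y'); lra.
(* Subtracting [a] from a nonnegative x, or adding it to a negative one, lands in the window since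
   [a <= sigma]. Hence the factor 1/2 between 7/64 and 7/128. *)
rewrite /= -radD mulrC -radZ; apply: rad_le => x; rewrite ler_pM2l ?invr_gt0//.
have [xs|_] := leP `|x| (sigma + a); last by rewrite addr_ge0.
have [x0|x0] := leP 0 x.
  rewrite [X in _ <= _ + X](_ : _ = 1) ?lerDr//.
  suff -> : `|- a + x| <= sigma by [].
  by move: xs; rewrite !ler_norml; lra.
rewrite [X in _ <= X + _](_ : _ = 1) ?lerDl//.
suff -> : `|a + x| <= sigma by [].
by move: xs; rewrite !ler_norml; lra.
Qed.

End SmallBall.

(** * Gain from one transfer between two coefficients *)

Section PairTransfer.
Variable R : realType.
Implicit Types (a b c d m p q r w sigma : R).

(* E|r + w eps|^3 for m = |w| and r >= 0; as a function of r^2 it is convex. *)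
Definition cubeavg m r : R :=
  if m <= r then r ^+ 3 + 3 * r * m ^+ 2 else m ^+ 3 + 3 * m * r ^+ 2.

Lemma cubeavgE w r :
  `|r + w| ^+ 3 + `|r - w| ^+ 3 = 2 * cubeavg `|w| `|r|.
Proof.
wlog r0 : r / 0 <= r.
  move=> H; have [|r0] := leP 0 r; first exact: H.
  have := H (- r); rewrite oppr_ge0 ltW// normrN => /(_ isT) <-.
  by rewrite addrC; congr (_ ^+ 3 + _ ^+ 3);
    rewrite -normrN; congr (`|_|); ring.
wlog w0 : w / 0 <= w.
  move=> H; have [|w0] := leP 0 w; first exact: H.
  have := H (- w); rewrite oppr_ge0 ltW// normrN => /(_ isT) <-.
  by rewrite opprK addrC.
rewrite /cubeavg (ger0_norm (addr_ge0 r0 w0)) (ger0_norm r0) (ger0_norm w0).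
case: (leP w r) => wr; first by rewrite ger0_norm ?subr_ge0//; ring.
by rewrite ler0_norm ?subr_le0 ?ltW//; ring.
Qed.

(** As a function of r^2, [cubeavg m] has slope 3m up to r = m and slope 3/2 (r + m^2/r) >= 3m
    beyond. *)
Lemma cubeavg_tangent_ge m p q : 0 <= m -> 0 <= p -> p <= q ->
  3 * m * (q ^+ 2 - p ^+ 2) <= cubeavg m q - cubeavg m p.
Proof.
move=> m0 p0 pq; rewrite /cubeavg; case: (leP m q) => mq; case: (leP m p) => mp.
- rewrite [leRHS](_ : _ = (q - p) * (p ^+ 2 + p * q + q ^+ 2 + 3 * m ^+ 2));
    last by ring.
  rewrite [leLHS](_ : _ = (q - p) * (3 * m * (p + q))); last by ring.
  by rewrite ler_wpM2l ?subr_ge0//; nra.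
- have : 0 <= (q - m) ^+ 3 by rewrite exprn_ge0// subr_ge0.
  nra.
- lra.
- nra.
Qed.

(** By convexity in r^2, a chord to the left of sigma^2 is no steeper than the tangent at
    sigma^2. *)
Lemma cubeavg_slope_le m p q sigma : 0 <= m -> 0 <= p -> p <= q ->
    q <= sigma -> m <= sigma -> 0 < sigma ->
  cubeavg m q - cubeavg m p <=
    3 / 2 * (sigma + m ^+ 2 / sigma) * (q ^+ 2 - p ^+ 2).
Proof.
move=> m0 p0 pq qs ms s0.
have slope t : 0 < t -> t <= sigma -> m <= t ->
    t + m ^+ 2 / t <= sigma + m ^+ 2 / sigma.
  move=> t0 ts mt; rewrite -subr_ge0.
  rewrite (_ : _ - _ = (sigma - t) * (1 - m ^+ 2 / (sigma * t))); last first.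
    by field; rewrite !gt_eqF.
  rewrite mulr_ge0 ?subr_ge0// ler_pdivrMr ?mulr_gt0// mul1r; nra.
have q2p2 : 0 <= q ^+ 2 - p ^+ 2 by nra.
have amgm : 3 * m <= 3 / 2 * (sigma + m ^+ 2 / sigma).
  rewrite -subr_ge0 (_ : _ - _ = 3 / 2 * ((sigma - m) ^+ 2 / sigma)).
    by rewrite mulr_ge0// divr_ge0 ?sqr_ge0// ltW.
  by field; rewrite gt_eqF.
have outer t : m <= t -> t <= q -> q ^+ 3 + 3 * q * m ^+ 2 -
    (t ^+ 3 + 3 * t * m ^+ 2) <=
    3 / 2 * (sigma + m ^+ 2 / sigma) * (q ^+ 2 - t ^+ 2).
  move=> mt tq; have [->|tq'] := eqVneq t q; first by rewrite !subrr mulr0.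
  have q_gt0 : 0 < q by have : t < q; [rewrite lt_neqAle tq'|lra].
  have q2t2 : 0 <= q ^+ 2 - t ^+ 2 by nra.
  apply: le_trans (_ : 3 / 2 * (q + m ^+ 2 / q) * (q ^+ 2 - t ^+ 2) <= _).
    rewrite -subr_ge0 (_ : _ - _ =
      2^-1 * (q - t) ^+ 2 * (q + 2 * t - 3 * (m ^+ 2 / q))).
      apply: mulr_ge0; first by rewrite mulr_ge0 ?sqr_ge0 ?invr_ge0.
      rewrite subr_ge0.
      have : m ^+ 2 / q <= t by rewrite ler_pdivrMr//; nra.
      lra.
    by field; rewrite gt_eqF.
  by rewrite ler_wpM2r// ler_pM2l// slope//; lra.
rewrite /cubeavg; case: (leP m q) => mq; case: (leP m p) => mp.
- exact: outer.
- have := outer m (lexx m) mq.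
  have : 3 * m * (m ^+ 2 - p ^+ 2) <=
      3 / 2 * (sigma + m ^+ 2 / sigma) * (m ^+ 2 - p ^+ 2).
    by rewrite ler_wpM2r//; nra.
  lra.
- lra.
- have : 3 * m * (q ^+ 2 - p ^+ 2) <=
      3 / 2 * (sigma + m ^+ 2 / sigma) * (q ^+ 2 - p ^+ 2).
    by rewrite ler_wpM2r.
  lra.
Qed.

(** Strict convexity to the right of sigma^2, made quantitative: the subtracted term is the
    increment of the tangent at sigma^2. *)
Lemma cubeavg_gain m p q sigma (U1 U2 : R) : 0 <= m -> m <= sigma ->
    0 < sigma -> sigma <= p -> 0 <= q -> 0 <= U1 -> U1 <= U2 ->
    U2 <= sigma ^+ 2 ->
    p ^+ 2 = sigma ^+ 2 + U1 -> q ^+ 2 = sigma ^+ 2 + U2 ->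
  (U2 ^+ 3 - U1 ^+ 3) / (27 * sigma ^+ 3) <= cubeavg m q - cubeavg m p
    - 3 / 2 * (sigma + m ^+ 2 / sigma) * (q ^+ 2 - p ^+ 2).
Proof.
move=> m0 ms s0 sp q0 U10 U12 U2s pE qE.
have p0 : 0 < p by lra.
have pq : p <= q by rewrite -(ler_pXn2r (_ : 0 < 2)%N) ?nnegrE//; lra.
have q32 : q <= 3 / 2 * sigma.
  by rewrite -(ler_pXn2r (_ : 0 < 2)%N) ?nnegrE//; nra.
(* Lower bounds for [q - p] and [p - sigma], since [q + p] and [p + sigma] are at most 3 sigma. The
   left side becomes (e + f)^3 - f^3. *)
pose e := (U2 - U1) / (3 * sigma); pose f := U1 / (3 * sigma).
have U1E : U1 = 3 * sigma * f by rewrite /f; field; rewrite gt_eqF.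
have dE : U2 - U1 = 3 * sigma * e by rewrite /e; field; rewrite gt_eqF.
have e0 : 0 <= e by rewrite divr_ge0//; lra.
have f0 : 0 <= f by rewrite divr_ge0//; lra.
have eqp : e <= q - p.
  rewrite /e ler_pdivrMr ?mulr_gt0//.
  rewrite (_ : U2 - U1 = (q - p) * (q + p)); last by rewrite -subr_sqr; lra.
  by rewrite ler_wpM2l//; lra.
have fps : f <= p - sigma.
  rewrite /f ler_pdivrMr ?mulr_gt0//.
  rewrite (_ : U1 = (p - sigma) * (p + sigma)); last by rewrite -subr_sqr; lra.
  by rewrite ler_wpM2l//; lra.
rewrite [leLHS](_ : _ = e ^+ 3 + 3 * e ^+ 2 * f + 3 * e * f ^+ 2); last first.
  by rewrite /e /f; field; rewrite gt_eqF.
rewrite /cubeavg !ifT; [|lra..].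
(* The first two summands are the remainder of the tangent at p^2; the third is the change of slope
   from sigma^2 to p^2. They dominate e^3, 3 e^2 f and 3 e f^2 in turn. *)
rewrite [leRHS](_ : _ = (q - p) ^+ 3
    + (q - p) ^+ 2 * ((p ^+ 2 - m ^+ 2) * (3 / 2 / p))
    + (p - sigma) * (1 - m ^+ 2 / (p * sigma)) * (3 / 2 * (q ^+ 2 - p ^+ 2)));
  last by field; rewrite !gt_eqF.
have ip : 1 / sigma <= 3 / 2 / p.
  by rewrite ler_pdivrMr// mulrAC ler_pdivlMr//; lra.
have i0 : 0 <= 1 / sigma by rewrite divr_ge0// ltW.
apply: lerD; first apply: lerD.
- by rewrite lerXn2r ?nnegrE ?subr_ge0.
- rewrite (_ : 3 * _ * _ = e ^+ 2 * (U1 * (1 / sigma))); last first.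
    by rewrite U1E; field; rewrite gt_eqF.
  apply: ler_pM; rewrite ?sqr_ge0 ?(mulr_ge0 U10)//.
    by rewrite lerXn2r ?nnegrE ?subr_ge0.
  by apply: ler_pM => //; nra.
- rewrite (_ : q ^+ 2 - p ^+ 2 = 3 * sigma * e); last by lra.
  rewrite [leLHS](_ : _ = f * (f * (1 / sigma * (2 / 3))) *
    (3 / 2 * (3 * sigma * e))); last by field; rewrite gt_eqF.
  apply: ler_wpM2r; first by have := mulr_ge0 (ltW s0) e0; lra.
  apply: ler_pM => //; first by apply: mulr_ge0 => //; lra.
  apply: (@le_trans _ _ ((p - sigma) * p^-1)).
    apply: ler_pM => //; first by apply: mulr_ge0 => //; lra.
    by move: ip; rewrite -[_ / p]mulrA; lra.
  rewrite mulrBl divff ?gt_eqF// lerB// ler_pdivrMr ?mulr_gt0//.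
  rewrite (_ : sigma / p * _ = sigma ^+ 2); last by field; rewrite gt_eqF.
  by rewrite lerXn2r ?nnegrE ?(ltW s0).
Qed.

(** A pair x, y enters through (x + y)^2 = sigma^2 + 2xy and (x - y)^2 = sigma^2 - 2xy. A larger
    product moves these apart by equal amounts, which increases a sum of convex values. *)
Lemma rad_pair_gain a b c d sigma (w : seq R) :
    0 <= a -> 0 <= b -> 0 <= c -> 0 <= d -> 0 < sigma -> sigma <= 1 ->
    a ^+ 2 + b ^+ 2 = sigma ^+ 2 -> c ^+ 2 + d ^+ 2 = sigma ^+ 2 ->
    a * b <= c * d ->
    (forall u, u \in w -> 0 <= u <= sigma) -> \sum_(u <- w) u ^+ 2 <= 1 ->
  c * d * ((c * d) ^+ 2 - (a * b) ^+ 2) / (125 * sigma ^+ 2) <=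
    rad [:: c, d & w] (fun x => `|x| ^+ 3) -
    rad [:: a, b & w] (fun x => `|x| ^+ 3).
Proof.
move=> a0 b0 c0 d0 s0 s1 abs cds abcd ws w1.
have radE x y : 0 <= x -> 0 <= y -> rad [:: x, y & w] (fun z => `|z| ^+ 3) =
    rad w (fun z => (cubeavg `|z| (x + y) + cubeavg `|z| `|x - y|) / 2).
  move=> x0 y0; transitivity (rad w (fun z => 4^-1 *
    (((`|x + (y + z)| ^+ 3 + `|x + (- y + z)| ^+ 3) +
    `|- x + (y + z)| ^+ 3) + `|- x + (- y + z)| ^+ 3))).
    by rewrite radZ !radD /=; field.
  apply: eq_rad => z.
  have := cubeavgE z (x + y); have := cubeavgE z (x - y).
  rewrite (ger0_norm (addr_ge0 x0 y0)).
  rewrite (_ : `|- x + (y + z)| = `|x - y - z|); last first.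
    by rewrite -normrN; congr (`|_|); ring.
  rewrite (_ : `|- x + (- y + z)| = `|x + y - z|); last first.
    by rewrite -normrN; congr (`|_|); ring.
  rewrite !addrA; lra.
rewrite !radE// lerBrDr.
pose K := ((2 * (c * d)) ^+ 3 - (2 * (a * b)) ^+ 3) / (27 * sigma ^+ 3) / 2.
have U1 : 0 <= 2 * (a * b) by rewrite !mulr_ge0.
have U12 : 2 * (a * b) <= 2 * (c * d) by lra.
have U2 : 2 * (c * d) <= sigma ^+ 2 by have := sqr_ge0 (c - d); lra.
have K0 : 0 <= K.
  rewrite !divr_ge0 ?mulr_ge0 ?exprn_ge0 ?(ltW s0)// subr_ge0.
  by rewrite lerXn2r// nnegrE; lra.
have pE : (a + b) ^+ 2 = sigma ^+ 2 + 2 * (a * b) by rewrite -abs; ring.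
have qE : (c + d) ^+ 2 = sigma ^+ 2 + 2 * (c * d) by rewrite -cds; ring.
have pE' : `|a - b| ^+ 2 = sigma ^+ 2 - 2 * (a * b).
  by rewrite real_normK ?num_real// -abs; ring.
have qE' : `|c - d| ^+ 2 = sigma ^+ 2 - 2 * (c * d).
  by rewrite real_normK ?num_real// -cds; ring.
have sp : sigma <= a + b.
  by rewrite -(ler_pXn2r (_ : 0 < 2)%N) ?nnegrE ?addr_ge0 ?(ltW s0)//; lra.
have pq : a + b <= c + d.
  by rewrite -(ler_pXn2r (_ : 0 < 2)%N) ?nnegrE ?addr_ge0 ?(ltW s0)//; lra.
have qp : `|c - d| <= `|a - b|.
  by rewrite -(ler_pXn2r (_ : 0 < 2)%N) ?nnegrE//; lra.
have ps : `|a - b| <= sigma.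
  by rewrite -(ler_pXn2r (_ : 0 < 2)%N) ?nnegrE ?(ltW s0)//; lra.
(* If |z| <= sigma, comparing both increments with the tangent at sigma^2 gains [K]. Otherwise the
   inner values lie on the affine branch of slope 3|z|, and nothing is lost. *)
apply: (@le_trans _ _ (rad w (fun z => K * (`|z| <= sigma)%R%:R +
    (cubeavg `|z| (a + b) + cubeavg `|z| `|a - b|) / 2))); last first.
  apply: rad_le => z; have [zs|zs] := leP `|z| sigma.
    have := cubeavg_gain (normr_ge0 z) zs s0 sp (addr_ge0 c0 d0) U1 U12 U2
      pE qE.
    have := cubeavg_slope_le (normr_ge0 z) (normr_ge0 _) qp ps zs s0.
    rewrite pE' qE' pE qE mulr1n /K; lra.
  have := cubeavg_tangent_ge (normr_ge0 z) (addr_ge0 a0 b0) pq.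
  rewrite pE qE {4 6}/cubeavg !ifF ?pE' ?qE'; last 2 first.
  - by apply/negbTE; rewrite -ltNge; lra.
  - by apply/negbTE; rewrite -ltNge; lra.
  rewrite mulr0; lra.
rewrite radD lerD2r radZ.
apply: (@le_trans _ _ (K * (7 / 128 * sigma))); last first.
  by rewrite ler_wpM2l// rad_small_ball.
rewrite (_ : K * _ = ((c * d) ^+ 3 - (a * b) ^+ 3) * (7 / 864) / sigma ^+ 2);
  last by rewrite /K; field; rewrite gt_eqF.
rewrite [leLHS](_ : _ = c * d * ((c * d) ^+ 2 - (a * b) ^+ 2) / 125 /
  sigma ^+ 2); last by field; rewrite gt_eqF.
rewrite ler_pM2r ?invr_gt0 ?exprn_gt0//.
(* With A = ab and C = cd: 7/864 > 1/125, and C^3 - A^3 exceeds C (C^2 - A^2) by A^2 (C - A). *)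
have : 0 <= a * b by rewrite mulr_ge0.
move: (a * b) (c * d) abcd => A C AC A0.
have : 0 <= A ^+ 2 * (C - A) by rewrite mulr_ge0 ?sqr_ge0 ?subr_ge0.
have : 0 <= C * (C ^+ 2 - A ^+ 2).
  by rewrite mulr_ge0 ?subr_ge0 ?lerXn2r ?nnegrE; lra.
lra.
Qed.

End PairTransfer.

(** * Descent to equal coefficients *)

Section Descent.
Variable R : realType.

Lemma eq_of_le_sum (I : finType) (f g : I -> R) :
    (forall i, f i <= g i) -> \sum_i f i = \sum_i g i -> f =1 g.
Proof.
move=> fg sfg i; apply/eqP; rewrite eq_sym -subr_eq0; apply/eqP.
apply: (@psumr_eq0P _ _ xpredT (fun i => g i - f i)) => //.
- by move=> j _; rewrite subr_ge0.
- by rewrite sumrB sfg subrr.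
Qed.

Definition cubemean m (b : 'I_m.+1 -> R) : R :=
  rad [seq b i | i <- enum 'I_m.+1] (fun x => `|x| ^+ 3).

(** Permutation invariance brings [p] and [q] to the front. As [b p] is a maximum, the other
    coefficients are at most sigma, as [rad_pair_gain] requires. *)
Lemma cubemean_transfer m (b c : 'I_m.+1 -> R) p q :
    p != q -> (forall i, 0 <= b i) -> (forall i, 0 <= c i) ->
    \sum_i b i ^+ 2 = 1 -> 0 < b p -> (forall i, b i <= b p) ->
    (forall i, i != p -> i != q -> c i = b i) ->
    c p ^+ 2 + c q ^+ 2 = b p ^+ 2 + b q ^+ 2 -> b p * b q <= c p * c q ->
  c p * c q * ((c p * c q) ^+ 2 - (b p * b q) ^+ 2) /
    (125 * (b p ^+ 2 + b q ^+ 2)) <= cubemean c - cubemean b.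
Proof.
move=> pq b0 c0 b1 bp bmax cb cE bc.
pose s := rem q (rem p (enum 'I_m.+1)).
have permE : perm_eq (enum 'I_m.+1) [:: p, q & s].
  apply: perm_trans (perm_to_rem (_ : p \in _)) _; first by rewrite mem_enum.
  rewrite perm_cons; apply: perm_to_rem.
  by rewrite mem_rem_uniq ?enum_uniq// !inE eq_sym pq mem_enum.
have s_neq i : i \in s -> i != p /\ i != q.
  have : uniq [:: p, q & s] by rewrite -(perm_uniq permE) enum_uniq.
  move=> /and3P[]; rewrite inE negb_or => /andP[_ ps] qs _ si.
  by split; apply/eqP => ie; rewrite -ie si in ps qs.
have meanE (d : 'I_m.+1 -> R) : cubemean d =
    rad [:: d p, d q & [seq d i | i <- s]] (fun x => `|x| ^+ 3).
  by apply: perm_rad; apply: (perm_map d permE).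
have csE : [seq c i | i <- s] = [seq b i | i <- s].
  by apply/eq_in_map => i /s_neq[ip iq]; apply: cb.
have sumE : b p ^+ 2 + b q ^+ 2 + \sum_(u <- [seq b i | i <- s]) u ^+ 2 = 1.
  rewrite -b1 big_map -(big_enum _ _ _ _) (perm_big _ permE) /= !big_cons.
  by rewrite addrA.
have s0 : 0 <= \sum_(u <- [seq b i | i <- s]) u ^+ 2.
  by apply: sumr_ge0 => u _; apply: sqr_ge0.
pose sigma := Num.sqrt (b p ^+ 2 + b q ^+ 2).
have bpq0 : 0 < b p ^+ 2 + b q ^+ 2.
  by rewrite ltr_pwDl ?exprn_gt0 ?sqr_ge0.
have sE : sigma ^+ 2 = b p ^+ 2 + b q ^+ 2 by rewrite sqr_sqrtr// ltW.
rewrite -sE !meanE csE; apply: rad_pair_gain => //.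
- by rewrite sqrtr_gt0.
- by rewrite -[leRHS]sqrtr1 ler_wsqrtr//; lra.
- by rewrite cE.
- move=> u /mapP[i _ ->]; rewrite b0 (le_trans (bmax i))//.
  rewrite -(ler_pXn2r (_ : 0 < 2)%N) ?nnegrE ?sqrtr_ge0// sE.
  by rewrite lerDl sqr_ge0.
- have := sqr_ge0 (b p); have := sqr_ge0 (b q); lra.
Qed.

(* The thresholds alpha k and beta k stand for the (k+1)-st largest and smallest
   entries: only the number of entries beyond them matters, and one step lowers
   that number by at most one, whence the shift of the sequences. *)
Lemma cubemean_descent m (A B : R) N :
  forall K (b : 'I_m.+1 -> R) (alpha beta : nat -> R),
    let v := m.+1%:R^-1 in
    (forall i, 0 <= b i) -> \sum_i b i ^+ 2 = 1 ->
    (forall i, B <= b i ^+ 2 <= A) ->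
    (#|[set i | b i ^+ 2 != v]| <= N)%N ->
    (forall k, (k < K)%N -> v < alpha k ->
      (k < #|[set i | (alpha k <= b i ^+ 2)%R]|)%N) ->
    (forall k, (k < K)%N -> beta k < v ->
      (k < #|[set i | (b i ^+ 2 <= beta k)%R]|)%N) ->
  cubemean b + (125 * (A + v))^-1 * (\sum_(k < K)
    Num.sqrt (v * (alpha k + B - v)) * Num.max (alpha k - v) 0 *
      Num.max (v - beta k) 0) <=
  cubemean (fun _ : 'I_m.+1 => Num.sqrt v).
Proof.
have card_gt0_ex (P : pred 'I_m.+1) k : (k < #|[set i | P i]|)%N ->
    exists i, P i.
  move=> kP; have /card_gt0P[i] := leq_ltn_trans (leq0n k) kP.
  by rewrite inE; exists i.
(* Once all squares equal [v], no threshold above [v] is attained, so every summand vanishes. *)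
have uniform K (b : 'I_m.+1 -> R) (alpha beta : nat -> R) (v := m.+1%:R^-1) :
    (forall i, 0 <= b i) -> (forall i, b i ^+ 2 = v) ->
    (forall k, (k < K)%N -> v < alpha k ->
      (k < #|[set i | (alpha k <= b i ^+ 2)%R]|)%N) ->
  cubemean b + (125 * (A + v))^-1 * (\sum_(k < K)
    Num.sqrt (v * (alpha k + B - v)) * Num.max (alpha k - v) 0 *
      Num.max (v - beta k) 0) <= cubemean (fun _ : 'I_m.+1 => Num.sqrt v).
  move=> b0 bv alphaP; rewrite big1 ?mulr0 ?addr0 => [|k _].
    rewrite le_eqVlt; apply/orP; left; apply/eqP.
    congr (rad _ _); apply: eq_map => i.
    by rewrite -(bv i) sqrtr_sqr ger0_norm.
  have [av|va] := leP (alpha k) v.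
    by rewrite (max_idPr _) ?subr_le0// mulr0 mul0r.
  have [i] := card_gt0_ex _ _ (alphaP k (ltn_ord k) va).
  by rewrite bv leNgt va.
elim: N => [|N IH] K b alpha beta v b0 b1 bAB cardN alphaP betaP.
  apply: uniform => // i; apply/eqP; apply: contraT => bi.
  by move: cardN; rewrite leqn0 cards_eq0 => /eqP/setP/(_ i); rewrite !inE bi.
have [bv|/existsNP[i0 bi0]] := pselect (forall i, b i ^+ 2 = v).
  exact: uniform.
have v0 : 0 < v by rewrite invr_gt0 ltr0n.
have sum_v : \sum_(i < m.+1) v = 1.
  by rewrite sumr_const card_ord -mulr_natl divff// pnatr_eq0.
have [p _ bmax'] := @arg_maxP _ _ _ ord0 xpredT b isT.
have [q _ bmin'] := @arg_minP _ _ _ ord0 xpredT b isT.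
have bmax i : b i <= b p by apply: bmax'.
have bmin i : b q <= b i by apply: bmin'.
have sqmax i : b i ^+ 2 <= b p ^+ 2 by rewrite lerXn2r ?nnegrE.
have sqmin i : b q ^+ 2 <= b i ^+ 2 by rewrite lerXn2r ?nnegrE.
(* The squares average to [v] without all being [v], so their extremes lie strictly on either
   side. *)
have vp : v < b p ^+ 2.
  rewrite ltNge; apply/negP => bpv; apply: bi0.
  apply: (@eq_of_le_sum _ (fun i => b i ^+ 2) (fun=> v));
    last by rewrite b1 sum_v.
  by move=> i; apply: le_trans (sqmax i) bpv.
have qv : b q ^+ 2 < v.
  rewrite ltNge; apply/negP => vbq; apply: bi0; apply: esym.
  apply: (@eq_of_le_sum _ (fun=> v) (fun i => b i ^+ 2));
    last by rewrite b1 sum_v.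
  by move=> i; apply: le_trans vbq (sqmin i).
have pq : p != q by apply: contraTneq vp => ->; rewrite -leNgt ltW.
pose c i := if i == p then Num.sqrt v else
  if i == q then Num.sqrt (b p ^+ 2 + b q ^+ 2 - v) else b i.
have cp : c p = Num.sqrt v by rewrite /c eqxx.
have cq : c q = Num.sqrt (b p ^+ 2 + b q ^+ 2 - v).
  by rewrite /c eq_sym (negbTE pq) eqxx.
have cE i : i != p -> i != q -> c i = b i.
  by rewrite /c => /negbTE -> /negbTE ->.
have bq2 := sqr_ge0 (b q).
have cp2 : c p ^+ 2 = v by rewrite cp sqr_sqrtr// ltW.
have cq2 : c q ^+ 2 = b p ^+ 2 + b q ^+ 2 - v by rewrite cq sqr_sqrtr//; lra.
have c0 i : 0 <= c i.
  by rewrite /c; case: ifP => // _; case: ifP => // _; rewrite sqrtr_ge0.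
have c1 : \sum_i c i ^+ 2 = 1.
  rewrite -b1 (bigD1 p)// (bigD1 q)/= 1?eq_sym// [RHS](bigD1 p)//.
  rewrite [X in _ = _ + X](bigD1 q)/= 1?eq_sym// cp2 cq2.
  rewrite (eq_bigr (fun i => b i ^+ 2)) => [|i /andP[ip iq]]; first by lra.
  by rewrite cE.
have bp0 : 0 < b p.
  by rewrite lt_neqAle b0 andbT; apply: contraTneq vp => <-;
    rewrite expr0n -leNgt ltW.
have cbE : (c p * c q) ^+ 2 - (b p * b q) ^+ 2 =
    (b p ^+ 2 - v) * (v - b q ^+ 2).
  by rewrite !exprMn cp2 cq2; ring.
have cb0 : 0 <= (c p * c q) ^+ 2 - (b p * b q) ^+ 2.
  by rewrite cbE mulr_ge0// subr_ge0 ltW.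
have gain := cubemean_transfer pq b0 c0 b1 bp0 bmax cE.
rewrite cbE cp2 cq2 in gain.
have {}gain : c p * c q * ((b p ^+ 2 - v) * (v - b q ^+ 2)) /
    (125 * (b p ^+ 2 + b q ^+ 2)) <= cubemean c - cubemean b.
  apply: gain; first by lra.
  by rewrite -(ler_pXn2r (_ : 0 < 2)%N) ?nnegrE ?mulr_ge0// -subr_ge0.
have cAB i : B <= c i ^+ 2 <= A.
  have := bAB i; have := bAB p; have := bAB q.
  have [->|ip] := eqVneq i p; first by rewrite cp2; lra.
  have [->|iq] := eqVneq i q; first by rewrite cq2; lra.
  by rewrite cE.
have cardc : (#|[set i | c i ^+ 2 != v]| <= N)%N.
  rewrite -ltnS (leq_trans _ cardN)//; apply: proper_card.
  apply/properP; split; last first.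
    by exists p; rewrite inE ?cp2 ?eqxx// gt_eqF.
  apply/fintype.subsetP => i; rewrite !inE.
  have [->|ip] := eqVneq i p; first by rewrite cp2 eqxx.
  have [->|iq] := eqVneq i q; first by rewrite (lt_eqF qv).
  by rewrite cE.
(* Only [p] can drop out of the count: an entry at or above a threshold exceeding [v] is not [q],
   and the rest are unchanged. *)
have alphaP' k : (k.+1 < K)%N -> v < alpha k.+1 ->
    (k < #|[set i | (alpha k.+1 <= c i ^+ 2)%R]|)%N.
  move=> kK va; have := alphaP _ kK va.
  rewrite (cardsD1 p) inE => H; rewrite -ltnS; apply: leq_trans H _.
  apply: leq_add (leq_b1 _) _; apply: subset_leq_card.
  apply/fintype.subsetP => i; rewrite !inE => /andP[ip ai].
  rewrite cE//; apply: contraTneq ai => ->.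
  by rewrite -ltNge (lt_trans qv).
have betaP' k : (k.+1 < K)%N -> beta k.+1 < v ->
    (k < #|[set i | (c i ^+ 2 <= beta k.+1)%R]|)%N.
  move=> kK va; have := betaP _ kK va.
  rewrite (cardsD1 q) inE => H; rewrite -ltnS; apply: leq_trans H _.
  apply: leq_add (leq_b1 _) _; apply: subset_leq_card.
  apply/fintype.subsetP => i; rewrite !inE => /andP[iq ai].
  rewrite cE//; apply: contraTneq ai => ->.
  by rewrite -ltNge (lt_trans _ vp).
case: K => [|K] in alphaP betaP alphaP' betaP' *.
  have := IH 0 c alpha beta c0 c1 cAB cardc.
  rewrite !big_ord0 mulr0 !addr0 => H.
  apply: le_trans (H _ _) => //.
  rewrite -subr_ge0; apply: le_trans gain.
  by rewrite -cbE divr_ge0 ?mulr_ge0// addr_ge0// sqr_ge0.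
rewrite big_ord_recl mulrDr.
have := IH K c (fun k => alpha k.+1) (fun k => beta k.+1) c0 c1 cAB cardc
  alphaP' betaP'.
(* This step pays for the first summand: [alpha 0] is at most the maximum, [beta 0] at least the
   minimum, and the two extremes add up to at most [A + v]. *)
suff : (125 * (A + v))^-1 * (Num.sqrt (v * (alpha 0 + B - v)) *
    Num.max (alpha 0 - v) 0 * Num.max (v - beta 0) 0) <=
    cubemean c - cubemean b by rewrite /= /v; lra.
apply: le_trans gain.
have rhs0 : 0 <= c p * c q * ((b p ^+ 2 - v) * (v - b q ^+ 2)) /
    (125 * (b p ^+ 2 + b q ^+ 2)).
  by rewrite -cbE divr_ge0 ?mulr_ge0// addr_ge0// sqr_ge0.
have [av|va] := leP (alpha 0) v.
  by rewrite (max_idPr _) ?subr_le0// mulr0 mul0r mulr0.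
have [vb|bv] := leP v (beta 0).
  have -> : Num.max (v - beta 0) 0 = 0 by apply/max_idPr; rewrite subr_le0.
  by rewrite !mulr0.
have [i ai] := card_gt0_ex _ _ (alphaP 0 (ltn0Sn _) va).
have [j bj] := card_gt0_ex _ _ (betaP 0 (ltn0Sn _) bv).
have {ai}ap := le_trans ai (sqmax i); have {bj}bq := le_trans (sqmin j) bj.
have := bAB p; have := bAB q; move=> /andP[Bq qA] /andP[Bp pA].
rewrite !(max_idPl _) ?subr_ge0 ?(ltW va) ?(ltW bv)//.
rewrite mulrC; apply: ler_pM.
- by rewrite -mulrA mulr_ge0 ?sqrtr_ge0// mulr_ge0// subr_ge0 ltW.
- by rewrite invr_ge0; lra.
- rewrite -mulrA; apply: ler_pM; rewrite ?sqrtr_ge0//.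
  + by rewrite mulr_ge0// subr_ge0 ltW.
  (* [Num.sqrt] is 0 on negative numbers, hence monotone on all reals; this covers a negative
     radicand on the left. *)
  + rewrite cp cq -sqrtrM ?(ltW v0)//; apply: ler_wsqrtr.
    by rewrite ler_pM2l//; lra.
  + by apply: ler_pM; lra.
- by rewrite lef_pV2 ?posrE ?pmulr_rgt0// ?ler_pM2l//; lra.
Qed.

End Descent.

(** * From the probability space to [rad] *)

Section RademacherIntegral.
Local Open Scope classical_set_scope.
Variables (R : realType) (d : measure_display) (T : measurableType d).
Variables (P : probability T R) (I : finType) (eps : I -> {RV P >-> R}).
Hypothesis radeps : forall i, rademacher (eps i).
Hypothesis indeps : mutually_independent eps.

Let cyl (J : {set I}) (e : I -> R) : set T :=
  \bigcap_(i in [set i | i \in J]) (eps i @^-1` [set e i]).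

Let cyl_measurable J e : measurable (cyl J e).
Proof.
apply: fin_bigcap_measurable => [|i _]; first exact: finite_finset.
by rewrite -[X in measurable X]setTI; apply: measurable_funP.
Qed.

Let prob_cyl J e : (forall i, e i = 1 \/ e i = -1) ->
  (P : {measure set T -> \bar R}) (cyl J e) = ((2^-1) ^+ #|J|)%:E.
Proof.
move=> eP; transitivity (P (cyl J e)) => //.
rewrite /cyl indeps => [|i]; last exact: measurable_set1.
rewrite -prodr_const -prodEFin; apply: eq_bigr => i _.
by case: (eP i) => ->; have [] := radeps i.
Qed.

(** Induction on the variables still to be averaged, the signs on [J] being fixed by the cylinder.
    Independence then enters only in the base case, as the probability 2^-|J| of a cylinder. *)
Lemma integral_rad (f : R -> R) (a : I -> R) (r : seq I) (J : {set I})
    (e : I -> R) :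
    measurable_fun setT f -> (forall x, 0 <= f x) ->
    uniq r -> (forall i, i \in r -> i \notin J) ->
    (forall i, e i = 1 \/ e i = -1) ->
  (\int[P]_(t in cyl J e) (f (\sum_(i <- r) a i * eps i t)%R)%:E =
    ((2^-1) ^+ #|J| * rad [seq a i | i <- r] f)%:E)%E.
Proof.
elim: r f J e => [|i r IH] f J e mf f0 /=.
  move=> _ _ eP; under eq_integral do rewrite big_nil.
  by rewrite integral_cst// (prob_cyl J eP) -EFinM mulrC.
move=> /andP[ir ur] rJ eP.
(* Conditioning on the sign of eps i matches the recursion of rad. *)
pose e1 s j : R := if j == i then s else e j.
have e1P s : s = 1 \/ s = -1 -> forall j, e1 s j = 1 \/ e1 s j = -1.
  by move=> sP j; rewrite /e1; case: ifP.
have iJ : i \notin J by apply: rJ; rewrite mem_head.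
have rJ' j : j \in r -> j \notin i |: J.
  move=> jr; rewrite !inE negb_or rJ ?inE ?jr ?orbT// andbT.
  by apply: contraNneq ir => <-.
have cyl1 s : cyl (i |: J) (e1 s) = cyl J e `&` eps i @^-1` [set s].
  apply/seteqP; split => [t /= Ht|t [Ht ti] j /=].
    split => [j /= jJ|]; last first.
      by have := Ht i; rewrite /= !inE eqxx /e1 eqxx; apply.
    have := Ht j; rewrite /= !inE jJ orbT /e1.
    case: eqP => [ji|_]; last by apply.
    by rewrite ji (negbTE iJ) in jJ.
  rewrite !inE /e1; case: eqP => [->//|_ /= jJ]; exact: Ht.
have mpre s : measurable (eps i @^-1` [set s]).
  by rewrite -[X in measurable X]setTI; apply: measurable_funP.
(* The values 1 and -1 are taken only almost surely; the exceptional null set is discarded before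
   the cylinder is split in two. *)
pose N := ~` (eps i @^-1` [set 1] `|` eps i @^-1` [set -1]).
have N0 : P N = 0%E.
  have [r1 r2] := radeps i.
  rewrite probability_setC; last exact: measurableU.
  have -> : P (eps i @^-1` [set 1] `|` eps i @^-1` [set -1]) = 1%E.
    pose A s := eps i @^-1` [set s].
    transitivity (P (A 1%R) + P (A (-1)%R))%E.
      apply: measureU => //.
      apply/seteqP; split => // t [/= -> H]; suff : (0 : R) < 0 by rewrite ltxx.
      lra.
    by rewrite r1 r2 -EFinD; congr EFin; lra.
  by rewrite subee.
have mF (g : R -> R) D s : measurable_fun setT g -> measurable D ->
    measurable_fun D (fun t => g (\sum_(j <- s) a j * eps j t)).
  move=> mg mD; apply: measurable_funTS.
  apply: measurableT_comp => //.
  by apply: measurable_sum => j; apply: measurable_funM.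
rewrite (@ge0_negligible_integral _ _ _ _ _ N)//.
- rewrite (_ : cyl J e `\` N = cyl (i |: J) (e1 1) `|` cyl (i |: J) (e1 (-1)));
    last by rewrite !cyl1 -setIUr /N setDE setCK.
  have disj : [disjoint cyl (i |: J) (e1 1) & cyl (i |: J) (e1 (-1))].
    rewrite !cyl1; apply/disj_setPS => t [[_ /= ->] [_ /= H]].
    suff : (0 : R) < 0 by rewrite ltxx.
    lra.
  have step s : s = 1 \/ s = -1 ->
      (\int[P]_(t in cyl (i |: J) (e1 s))
        (f (\sum_(j <- i :: r) a j * eps j t)%R)%:E =
      ((2^-1) ^+ #|J|.+1 *
        rad [seq a j | j <- r] (fun x => f (a i * s + x)))%:E)%E.
    move=> sP; have -> : #|J|.+1 = #|i |: J| by rewrite cardsU1 iJ.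
    rewrite -(IH _ _ (e1 s))//; first last.
    - exact: e1P.
    - by apply: measurableT_comp => //; apply: measurable_funD.
    apply: eq_integral => t; rewrite inE cyl1 => -[_ /= ti].
    by rewrite big_cons ti.
  rewrite ge0_integral_setU//.
  + rewrite (step 1) ?(step (-1)); [|by right|by left].
    by rewrite -EFinD; congr EFin; rewrite mulr1 mulrN1 exprS; field.
  + by apply/measurable_EFinP; apply: mF => //; apply: measurableU.
  + by move=> t _; rewrite lee_fin.
- by apply: measurableC; apply: measurableU.
- by apply/measurable_EFinP; apply: mF.
- by move=> t _; rewrite lee_fin.
Qed.
Lemma expectation_rad (f : R -> R) (a : I -> R) :
    measurable_fun setT f -> (forall x, 0 <= f x) ->
  ('E_P[(fun t => f (\sum_i a i * eps i t))%R] =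
    (rad [seq a i | i <- enum I] f)%:E)%E.
Proof.
move=> mf f0; rewrite unlock.
have := integral_rad a mf f0 (enum_uniq I) (J := finset.set0) (e := fun=> 1).
rewrite cards0 expr0 mul1r => <-; [|by move=> i; rewrite inE|by left].
rewrite (_ : cyl _ _ = setT).
  by apply: eq_integral => t _; rewrite big_enum.
by apply/seteqP; split => // t _ i /=; rewrite inE.
Qed.

End RademacherIntegral.

(* MathComp-Analysis world. The dimension is n = m.+1, and a_1, ..., a_n are
   a ord0, ..., a ord_max; a (rev_ord i) is the paper-indexed a_(n+1-i). *)
Theorem theorem3 (R : realType) :
  exists C3 : R, 0 < C3 /\
  forall (m : nat) (a : 'I_m.+1 -> R),
    (forall i j : 'I_m.+1, (i <= j)%N -> a j <= a i) ->
    (forall i : 'I_m.+1, 0 <= a i) ->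
    \sum_(i < m.+1) a i ^+ 2 = 1 ->
  forall (d : measure_display) (T : measurableType d) (P : probability T R)
    (eps : 'I_m.+1 -> {RV P >-> R}),
    (forall i : 'I_m.+1, rademacher (eps i)) ->
    mutually_independent eps ->
  let n : R := m.+1%:R in
  let S : T -> R := fun t => \sum_(i < m.+1) a i * eps i t in
  let Sn : T -> R := fun t => (Num.sqrt n)^-1 * \sum_(i < m.+1) eps i t in
  ('E_P[(fun t => `|S t| ^+ 3)%R] <=
   'E_P[(fun t => `|Sn t| ^+ 3)%R] -
   (C3 / (a ord0 ^+ 2 + n^-1) *
    \sum_(i < m.+1)
      Num.sqrt (n^-1 * (a i ^+ 2 + a ord_max ^+ 2 - n^-1)) *
      Num.max (a i ^+ 2 - n^-1) 0 *
      Num.max (n^-1 - a (rev_ord i) ^+ 2) 0)%R%:E)%E.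
Proof.
(* The constant of [rad_pair_gain], which the descent preserves. *)
exists 125^-1; split=> [|m a a_dec a0 a1 d T P eps radeps indeps].
  by rewrite invr_gt0.
lazy zeta; set n : R := m.+1%:R.
have n0 : 0 < n by rewrite ltr0n.
have mcube : measurable_fun setT (fun x : R => `|x| ^+ 3).
  by apply: measurable_funX; apply: normr_measurable.
have cube0 (x : R) : 0 <= `|x| ^+ 3 by rewrite exprn_ge0.
have -> : (fun t => `|(Num.sqrt n)^-1 * \sum_i eps i t| ^+ 3) =
    (fun t => `|\sum_i Num.sqrt n^-1 * eps i t| ^+ 3).
  by apply/funext => t; rewrite mulr_sumr sqrtrV// ltW.
rewrite (expectation_rad radeps indeps (fun=> Num.sqrt n^-1) mcube cube0).
rewrite (expectation_rad radeps indeps a mcube cube0).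
rewrite -EFinB lee_fin lerBrDr -invfM.
have sq_dec (i j : 'I_m.+1) : (i <= j)%N -> a j ^+ 2 <= a i ^+ 2.
  by move=> ij; rewrite lerXn2r ?nnegrE// a_dec.
have card_ge (Q : pred 'I_m.+1) (g : 'I_m.+1 -> 'I_m.+1) k : injective g ->
    (k < m.+1)%N -> (forall i : 'I_m.+1, (i <= k)%N -> Q (g i)) ->
    (k < #|[set i | Q i]|)%N.
  move=> g_inj km Qg; rewrite -[X in (X <= _)%N]card_ord.
  have widen_inj : injective (widen_ord km).
    by move=> i j /(congr1 val) /= /val_inj.
  rewrite -(card_imset _ (inj_comp g_inj widen_inj)).
  apply: subset_leq_card; apply/fintype.subsetP => _ /imsetP[i _ ->].
  by rewrite inE; apply: Qg; rewrite /= -ltnS.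
(* The thresholds are the order statistics: with [k] counted from 0, they are the squares of a_(k+1)
   and a_(n-k). The first k + 1 indices, reversed for [beta], witness the counts. *)
have := @cubemean_descent _ _ (a ord0 ^+ 2) (a ord_max ^+ 2) _ m.+1 a
  (fun k => a (inord k) ^+ 2) (fun k => a (rev_ord (inord k)) ^+ 2) a0 a1 _
  (leqnn _).
under eq_bigr do rewrite inord_val.
apply.
- by move=> i; rewrite !sq_dec// -ltnS.
- move=> k km _; apply: (@card_ge _ id) => // i ik.
  by rewrite sq_dec// inordK.
- move=> k km _; apply: (@card_ge _ _ _ rev_ord_inj) => // i ik.
  by rewrite sq_dec//= inordK// leq_sub2l.
Qed.
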